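(* Let $(\mathscr{K}_\varepsilon)_{\varepsilon\in\mathbb{R}_+}$ be a filtered simplicial complex whose structure morphisms are inclusions. For every $\varepsilon\in\mathbb{R}_+$ and every $k\in\mathbb{N}$, the cophenetic rank function $c^k_\varepsilon\colon F_k^\varepsilon\to\mathbb{N}$ is submodular, i.e. $c^k_\varepsilon(A\cup B)\le c^k_\varepsilon(A)+c^k_\varepsilon(B)-c^k_\varepsilon(A\cap B)$ for all $A,B\in F_k^\varepsilon$. Thus, for every $k\ge 0$, the pairs $M^k_\varepsilon=(Z_k^\varepsilon,c^k_\varepsilon)$, together with the maps $\psi^k_{\varepsilon,\eta}\colon Z_k^\varepsilon\to Z_k^\eta$ for $\varepsilon\le\eta$, form a filtered matroid $(M^k_\varepsilon)_{\varepsilon\in\mathbb{R}_+}$ over $\mathbb{R}_+$.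
   Context: $\mathbb{R}_+$ is the set of non-negative real numbers with its natural order. A filtered simplicial complex with inclusions as structure morphisms is a family of simplicial complexes with $\mathscr{K}_\varepsilon\subseteq\mathscr{K}_\eta$ whenever $\varepsilon\le\eta$. Chains are taken with coefficients in $\mathbb{R}$. For $k\ge0$, $d_k^\varepsilon$ is the simplicial boundary map out of the $k$-chains of $\mathscr{K}_\varepsilon$; $Z_k^\varepsilon=\ker(d_k^\varepsilon)$ is the space of cycles and $B_k^\varepsilon=\operatorname{im}(d_{k+1}^\varepsilon)$ the space of boundaries. For $\varepsilon\le\eta$, $\psi^k_{\varepsilon,\eta}\colon Z_k^\varepsilon\to Z_k^\eta$ is the injective linear map induced by the inclusion $\mathscr{K}_\varepsilon\subseteq\mathscr{K}_\eta$. $F_k^\varepsilon$ is the set of all finite subsets of $Z_k^\varepsilon$. The cophenetic rank function is $$c^k_\varepsilon(A)=\dim(\operatorname{Span}_{\mathbb{R}}(A)+B_k^\varepsilon)-\dim B_k^\varepsilon=\dim\operatorname{Span}_{\mathbb{R}}(A)-\dim(\operatorname{Span}_{\mathbb{R}}(A)\cap B_k^\varepsilon)$$ (if $B_k^\varepsilon$ is infinite dimensional, the last expression is used). A matroid is identified with its rank function: it is a pair $(E,r)$, where $r$ is an $\mathbb{N}$-valued function on the finite subsets of $E$ which is monotone under inclusion, satisfies $r(A)\le|A|$, and is submodular. A filtered matroid over a poset $P$ is a family of matroids $(E_\varepsilon,r_\varepsilon)_{\varepsilon\in P}$ with functions $\psi_{\varepsilon,\eta}\colon E_\varepsilon\to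 E_\eta$ for all $\varepsilon\le\eta$ such that $\psi_{\eta,\nu}\circ\psi_{\varepsilon,\eta}=\psi_{\varepsilon,\nu}$ for $\varepsilon\le\eta\le\nu$ and $r_\eta(\psi_{\varepsilon,\eta}(A))\le r_\varepsilon(A)$ for every finite $A\subseteq E_\varepsilon$. *)

(* Defs.v *)
From mathcomp Require Import all_boot all_order all_algebra.
From mathcomp Require Import finmap.
From mathcomp Require Import boolp classical_sets reals interval_inference.
From mathcomp Require Import multinomials.monalg.

Set Implicit Arguments.
Unset Strict Implicit.
Unset Printing Implicit Defensive.

Import Order.TTheory GRing.Theory Num.Theory.

Local Open Scope ring_scope.
Local Open Scope fset_scope.
Local Open Scope classical_set_scope.

(* Spans and dimensions in a possibly infinite-dimensional vector space:      *)
(* vectType only covers the finite-dimensional case.                          *)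

Definition lspan (F : fieldType) (M : lmodType F) (s : seq M) : set M :=
  [set v | exists a : 'I_(size s) -> F, v = \sum_(i < size s) a i *: s`_i].

Definition lfree (F : fieldType) (M : lmodType F) (s : seq M) : Prop :=
  forall a : 'I_(size s) -> F,
    \sum_(i < size s) a i *: s`_i = 0 -> forall i, a i = 0.

Definition lbasis (F : fieldType) (M : lmodType F) (U : set M) (s : seq M) :
    Prop :=
  lfree s /\ lspan s = U.

(* The value is 0 by convention when U has no finite basis. *)
Definition ldim (F : fieldType) (M : lmodType F) (U : set M) : nat :=
  xget 0%N [set n | exists s : seq M, lbasis U s /\ size s = n].

(* Abstract simplicial complexes on vertices in V; not every element of V is  *)
(* required to be a vertex.                                                   *)
Record simplicial_complex (V : choiceType) := SimplicialComplex {
  simplices :> set {fset V};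
  simplices_neq0 : forall s, simplices s -> s != fset0;
  simplices_face : forall s t,
    simplices s -> (t `<=` s)%fset -> t != fset0 -> simplices t
}.

Section Chains.
Context (R : realType) (disp : Order.disp_t) (V : orderType disp).
Implicit Types (K L : simplicial_complex V) (k : nat).

(* The chains of all the subcomplexes of the full simplex on V live in the    *)
(* free R-module on {fset V}, so that the maps induced by inclusions of       *)
(* complexes are inclusions of subspaces. The order on V orients simplices.   *)
Local Notation chain := {malg R[{fset V}]}.

Definition chains K k : set chain :=
  [set c | forall s : {fset V}, s \in msupp c -> simplices K s /\ #|` s| = k.+1].

(* If s = {v_0 < ... < v_k}, the cardinal below is the i such that v = v_i. *)
Definition simplex_boundary (s : {fset V}) : chain :=
  \sum_(v <- s)
    (-1) ^+ #|` [fset w in s | (w < v)%O]%fset| *: << (s `\ v)%fset >>.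

Definition boundary k (c : chain) : chain :=
  if k is 0%N then 0
  else \sum_(s <- msupp c) c@_s *: simplex_boundary s.

Definition cycles K k : set chain :=
  [set z | chains K k z /\ boundary k z = 0].

Definition boundaries K k : set chain :=
  boundary k.+1 @` chains K k.+1.

(* The second space is contained in the first, so the subtraction in nat is   *)
(* exact; both are finite-dimensional even if boundaries K k is not.          *)
Definition cophenetic_rank K k (A : {fset cycles K k}) : nat :=
  let S := lspan [fset val z | z in A]%fset in
  (ldim S - ldim (S `&` boundaries K k))%N.

Lemma sub_cycles K L k : K `<=` L -> cycles K k `<=` cycles L k.
Proof.
move=> KL z [Kz dz]; split=> // s /Kz[Ks sk].
by split=> //; apply: KL.
Qed.

Definition cycles_incl K L k (KL : K `<=` L) (z : cycles K k) : cycles L k :=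
  exist _ (val z) (mem_set (sub_cycles KL (set_mem (valP z)))).

End Chains.

Arguments chains R {disp V} K k.
Arguments cycles R {disp V} K k.
Arguments boundaries R {disp V} K k.
Arguments cophenetic_rank R {disp V} K k A.
Arguments cycles_incl R {disp V K L} k KL z.

(* The term r (A `&` B) is moved to the left to avoid subtraction in nat.     *)
Definition submodular (E : choiceType) (r : {fset E} -> nat) : Prop :=
  forall A B : {fset E},
    (r (A `|` B)%fset + r (A `&` B)%fset <= r A + r B)%N.

Record is_matroid (E : choiceType) (r : {fset E} -> nat) : Prop := IsMatroid {
  matroid_mono : forall A B : {fset E}, (A `<=` B)%fset -> (r A <= r B)%N;
  matroid_le_card : forall A : {fset E}, (r A <= #|` A|)%N;
  matroid_submod : submodular r
}.

Record is_filtered_matroid (disp : Order.disp_t) (P : porderType disp)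
    (E : P -> choiceType) (r : forall p, {fset E p} -> nat)
    (psi : forall p q, (p <= q)%O -> E p -> E q) : Prop := IsFilteredMatroid {
  filtered_is_matroid : forall p, is_matroid (r p);
  filtered_comp : forall p q t (pq : (p <= q)%O) (qt : (q <= t)%O)
      (pt : (p <= t)%O) (x : E p),
    psi q t qt (psi p q pq x) = psi p t pt x;
  filtered_rank : forall p q (pq : (p <= q)%O) (A : {fset E p}),
    (r q [fset psi p q pq x | x in A]%fset <= r p A)%N
}.

(* Main.v *)
(* In coordinates with respect to a basis of Span(A ∪ B), which contains all
   the spans involved, subspaces become row spaces of matrices. If N is the matrix
   of the trace of the space of boundaries and X the one of Span(A), then
   c(A) = rank (X + N) - rank N, so submodularity and monotonicity of c follow
   from those of the rank. Enlarging the complex does not change Span(A) but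
   enlarges the space of boundaries, hence c can only decrease. *)
Require Import Defs.
From HB Require Import structures.
From mathcomp Require Import all_boot all_order all_algebra.
From mathcomp Require Import finmap.
From mathcomp Require Import boolp classical_sets reals interval_inference.
From mathcomp Require Import multinomials.monalg.

Set Implicit Arguments.
Unset Strict Implicit.
Unset Printing Implicit Defensive.

Import GRing.Theory.

Local Open Scope ring_scope.
Local Open Scope classical_set_scope.

(** * Spans, bases and coordinates in a vector space of arbitrary dimension *)

Section LinearAlgebra.
Context (F : fieldType).

Definition subspace (M : lmodType F) (U : set M) : Prop :=
  U 0 /\ forall a u v, U u -> U v -> U (a *: u + v).

(** Coefficients form a row vector, so that sets of coefficients can be compared with row spaces of
    matrices. *)
Definition lcomb (M : lmodType F) (s : seq M) (u : 'rV[F]_(size s)) : M :=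
  \sum_(i < size s) u 0 i *: s`_i.

Lemma lcomb_linear (M : lmodType F) (s : seq M) : linear (@lcomb M s).
Proof.
move=> a u v; rewrite /lcomb scaler_sumr -big_split; apply: eq_bigr => i _.
by rewrite !mxE scalerDl scalerA.
Qed.

HB.instance Definition _ (M : lmodType F) (s : seq M) :=
  GRing.isLinear.Build F 'rV[F]_(size s) M *:%R (@lcomb M s) (@lcomb_linear M s).

(** Take [A] of maximal rank among the matrices with row space inside [P]: a vector of [P] outside
    this row space could be adjoined and would raise the rank. *)
Lemma row_subspaceP n (P : set 'rV[F]_n) : subspace P ->
  exists A : 'M[F]_n, forall u, (u <= A)%MS <-> P u.
Proof.
move=> [P0 PD].
pose Q r := `[< exists A : 'M[F]_n, \rank A = r /\ forall u, (u <= A)%MS -> P u >].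
have exQ : exists r, Q r.
  exists 0%N; apply/asboolP; exists 0; split; first exact: mxrank0.
  by move=> u; rewrite submx0 => /eqP ->.
have Qle r : Q r -> (r <= n)%N by move=> /asboolP[A [<- _]]; exact: rank_leq_row.
case: (ex_maxnP exQ Qle) => r /asboolP[A [rA AP]] maxr.
exists A => u; split=> [/AP //|Pu]; apply/negPn/negP => uA.
have : Q (\rank (A + u)%MS).
  apply/asboolP; exists (A + u)%MS; split=> // v /sub_addsmxP[[w c] /= ->].
  have -> : c *m u = c 0 0 *: u by rewrite -mul_scalar_mx -mx11_scalar.
  by rewrite addrC; apply: PD => //; apply/AP/submxMl.
move=> /maxr; apply/negP; rewrite -ltnNge -rA; apply: rank_ltmx.
by rewrite /ltmx addsmxSl addsmx_sub submx_refl (negPf uA).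
Qed.

Context (M : lmodType F).
Implicit Types (U W Y : set M) (s t b : seq M).

Lemma subspaceI U W : subspace U -> subspace W -> subspace (U `&` W).
Proof.
move=> [U0 UD] [W0 WD]; split=> // a u v [Uu Wu] [Uv Wv].
by split; [apply: UD|apply: WD].
Qed.

Lemma lspanP s v : lspan s v <-> exists u : 'rV_(size s), v = lcomb u.
Proof.
split=> [[a ->]|[u ->]]; last by exists (u 0).
by exists (\row_i a i); apply: eq_bigr => i _; rewrite mxE.
Qed.

Lemma lfreeP s : lfree s <-> injective (@lcomb M s).
Proof.
split=> [fs u v /eqP|inj a a0 i].
  rewrite -subr_eq0 -linearB => /eqP uv0; apply/rowP => i.
  by have := fs _ uv0 i; rewrite !mxE => /eqP; rewrite subr_eq0 => /eqP.
have : lcomb (\row_i a i) = lcomb (s := s) 0.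
  by rewrite linear0 -[RHS]a0; apply: eq_bigr => j _; rewrite mxE.
by move=> /inj /rowP /(_ i); rewrite !mxE.
Qed.

Lemma lspan_subspace s : subspace (lspan s).
Proof.
split; first by apply/lspanP; exists 0; rewrite linear0.
move=> a u v /lspanP[x ->] /lspanP[y ->]; apply/lspanP; exists (a *: x + y).
by rewrite linearP.
Qed.

Lemma mem_lspan s x : x \in s -> lspan s x.
Proof.
move=> xs; apply/lspanP; have ltx : (index x s < size s)%N by rewrite index_mem.
exists (delta_mx 0 (Ordinal ltx)); rewrite /lcomb (bigD1 (Ordinal ltx)) //=.
rewrite mxE !eqxx scale1r nth_index// big1 ?addr0// => i /negPf ni.
by rewrite mxE ni andbF scale0r.
Qed.

Lemma lspan_min s U : subspace U -> (forall x, x \in s -> U x) ->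
  lspan s `<=` U.
Proof.
move=> [U0 UD] sU v /lspanP[u ->]; rewrite /lcomb.
elim/big_ind: _ => // [x y Ux Uy|i _]; first by rewrite -[x]scale1r; apply: UD.
by rewrite -[_ *: _]addr0; apply: UD => //; apply: sU; exact: mem_nth.
Qed.

Lemma lspanS s t : {subset s <= t} -> lspan s `<=` lspan t.
Proof.
by move=> st; apply: lspan_min => [|x /st]; [exact: lspan_subspace|exact: mem_lspan].
Qed.

(** Induction on [s]: the head joins the basis of the span of the tail only if it lies outside that
    span. *)
Lemma lbasis_lspan s : exists2 b, lbasis (lspan s) b & (size b <= size s)%N.
Proof.
elim: s => [|x s [b [fb bs] sb]].
  by exists [::] => //; split=> // a _ [].
have [[x0 xD] [s0 sD]] := (lspan_subspace (x :: s), lspan_subspace s).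
have xin : lspan (x :: s) x by apply: mem_lspan; rewrite mem_head.
have ss : lspan s `<=` lspan (x :: s) by apply: lspanS => y ys; rewrite inE ys orbT.
have [xs|xNs] := pselect (lspan s x).
  exists b => //=; last exact: leqW.
  split=> //; rewrite bs; apply/seteqP; split=> //.
  apply: lspan_min => // y; rewrite inE => /orP[/eqP->//|]; exact: mem_lspan.
exists (x :: b) => //; split.
  move=> a; rewrite /= big_ord_recl /= => a0.
  have c0 : a ord0 = 0.
    apply: contrapT => /eqP c0; apply: xNs; rewrite -bs.
    (* These coefficients come from solving the relation [a0] for [x]. *)
    exists (fun i => - (a ord0)^-1 * a (lift ord0 i)).
    transitivity (- (a ord0)^-1 *: \sum_(i < size b) a (lift ord0 i) *: b`_i).
      move/eqP: a0; rewrite addrC addr_eq0 => /eqP ->.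
      by rewrite scalerN scaleNr opprK scalerA mulVf// scale1r.
    by rewrite scaler_sumr; apply: eq_bigr => i _; rewrite scalerA.
  move: a0; rewrite c0 scale0r add0r => a0 i.
  by have [j ->|->//] := unliftP ord0 i; exact: (fb (fun j => a (lift ord0 j))).
apply/seteqP; split; apply: lspan_min; try exact: lspan_subspace.
  move=> y; rewrite inE => /orP[/eqP->//|yb].
  by apply: ss; rewrite -bs; exact: mem_lspan.
move=> y; rewrite inE => /orP[/eqP->|/mem_lspan]; first by apply: mem_lspan; rewrite mem_head.
by rewrite -bs; apply: lspanS => z zb; rewrite inE zb orbT.
Qed.

(** [Y] may leave the span of [b]; [A] then records only its trace on that span. *)
Definition mx_represents b (A : 'M[F]_(size b)) Y : Prop :=
  forall u, (u <= A)%MS <-> Y (lcomb u).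

Lemma mx_represents_exists b Y : subspace Y ->
  exists A : 'M[F]_(size b), mx_represents A Y.
Proof.
move=> [Y0 YD]; apply: row_subspaceP; split=> [|a u v Yu Yv] /=.
  by rewrite linear0.
by rewrite linearP; exact: YD.
Qed.

(** The matrix [T] of coordinates of [t] in [b] has independent rows and the same row space as
    [A]. *)
Lemma lbasis_size b t U Y (A : 'M[F]_(size b)) : lbasis U b -> lbasis Y t ->
  Y `<=` U -> mx_represents A Y -> size t = \rank A.
Proof.
move=> [/lfreeP injb bU] [/lfreeP injt tY] YU AY.
have /choice[f fP] (i : 'I_(size t)) : exists u : 'rV_(size b), t`_i = lcomb u.
  by apply/lspanP; rewrite bU; apply: YU; rewrite -tY; exact/mem_lspan/mem_nth.
pose T := \matrix_i f i.
have TE x : lcomb (x *m T) = lcomb x :> M.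
  rewrite mulmx_sum_row linear_sum; apply: eq_bigr => i _.
  by rewrite fP linearZ rowK.
have /eqP <- : row_free T.
  apply: inj_row_free => x xT; apply: injt.
  by rewrite linear0 -TE xT linear0.
apply/eqP; rewrite eqn_leq; apply/andP; split; apply/mxrankS/rV_subP => u.
  by move=> /submxP[x ->]; apply/AY; rewrite TE -tY; apply/lspanP; exists x.
move=> /AY; rewrite -tY => /lspanP[x]; rewrite -TE => /injb ->.
exact: submxMl.
Qed.

(** All bases have the same size: in coordinates with respect to one of them, [U] is represented by
    the identity matrix. *)
Lemma ldim_lbasis U b : lbasis U b -> ldim U = size b.
Proof.
move=> bU; rewrite /ldim; apply: xget_subset1; first by exists b.
move=> _ _ [s [sU <-]] [t [tU <-]].
rewrite (lbasis_size (A := 1%:M) sU sU)//; last first.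
  by move=> u; rewrite submx1; split=> // _; case: sU => _ <-; apply/lspanP; exists u.
rewrite (lbasis_size (A := 1%:M) sU tU)//.
by move=> u; rewrite submx1; split=> // _; case: sU => _ <-; apply/lspanP; exists u.
Qed.

(** The rows of [A] give a finite family spanning [Y], hence a finite basis of [Y], to which
    [lbasis_size] applies. *)
Lemma ldim_represents b U Y (A : 'M[F]_(size b)) : lbasis U b -> Y `<=` U ->
  mx_represents A Y -> ldim Y = \rank A.
Proof.
move=> bU YU AY; have subY : subspace Y.
  split=> [|a u v Yu Yv].
    by rewrite -(linear0 (lcomb (s := b))); apply/AY; exact: sub0mx.
  have [Uu Uv] := (YU _ Yu, YU _ Yv); move: Uu Uv Yu Yv; case: (bU) => _ <-.
  move=> /lspanP[x ->] /lspanP[y ->] /AY xA /AY yA.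
  by rewrite -linearP; apply/AY; rewrite addmx_sub ?scalemx_sub.
pose s := [seq lcomb (row i A) | i <- enum 'I_(size b)].
have [t tY _] := lbasis_lspan s.
suff sY : lspan s = Y.
  by rewrite sY in tY; rewrite (ldim_lbasis tY) (lbasis_size bU tY YU AY).
apply/seteqP; split.
  apply: lspan_min => // _ /mapP[i _ ->]; apply/AY; exact: row_sub.
move=> v Yv; have Uv := YU _ Yv; move: Uv Yv; case: (bU) => _ <- /lspanP[x ->] /AY /submxP[y ->].
rewrite mulmx_sum_row linear_sum; have [s0 sD] := lspan_subspace s.
elim/big_ind: _ => // [u w su sw|i _]; first by rewrite -[u]scale1r; exact: sD.
rewrite linearZ -[X in lspan _ X]addr0; apply: sD => //.
by apply: mem_lspan; apply: map_f; rewrite mem_enum.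
Qed.

(** * Rank relative to a subspace: for finite-dimensional [U], the dimension of the image of [U]
    modulo [W] *)

Definition relrank W U : nat := (ldim U - ldim (U `&` W))%N.

(* [W] may be infinite-dimensional: only its trace on [U] matters, and [N] is the
   coordinate matrix of that trace. *)
Lemma relrank_represents b U W Y (A N : 'M[F]_(size b)) : lbasis U b ->
  Y `<=` U -> mx_represents A Y -> mx_represents N W ->
  (relrank W Y + \rank N = \rank (A + N)%MS)%N.
Proof.
move=> bU YU AY NW; rewrite /relrank (ldim_represents bU YU AY).
have YWU : Y `&` W `<=` U by move=> v [/YU].
rewrite (ldim_represents bU YWU (A := (A :&: N)%MS)); last first.
  by move=> u; rewrite sub_capmx; split=> [/andP[/AY ? /NW]//|[/AY -> /NW ->]].
(* The dimension formula for the sum and the intersection of [A] and [N]. *)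
by rewrite addnBAC ?mxrankS ?capmxSl// -mxrank_sum_cap addnK.
Qed.

Lemma relrank_size W s : (relrank W (lspan s) <= size s)%N.
Proof.
have [b bs] := lbasis_lspan s; apply: leq_trans; rewrite /relrank (ldim_lbasis bs).
exact: leq_subr.
Qed.

Lemma relrank_mono W s t : subspace W -> lspan s `<=` lspan t ->
  (relrank W (lspan s) <= relrank W (lspan t))%N.
Proof.
move=> subW st; have [b bt _] := lbasis_lspan t.
have [N NW] := mx_represents_exists b subW.
have [A AY] := mx_represents_exists b (lspan_subspace s).
have [C CY] := mx_represents_exists b (lspan_subspace t).
rewrite -(leq_add2r (\rank N)) (relrank_represents bt st AY NW).
rewrite (relrank_represents bt _ CY NW)//.
by apply/mxrankS/addsmxS => //; apply/rV_subP => u /AY/st/CY.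
Qed.

(** Only the subtracted term changes, and the trace on [lspan s] grows with [W]. *)
Lemma relrank_anti W W' s : subspace W -> subspace W' -> W `<=` W' ->
  (relrank W' (lspan s) <= relrank W (lspan s))%N.
Proof.
move=> subW subW' WW'; have [b bs _] := lbasis_lspan s.
have subsI := subspaceI (lspan_subspace s).
have [N NW] := mx_represents_exists b (subsI _ subW).
have [N' NW'] := mx_represents_exists b (subsI _ subW').
apply: leq_sub2l.
rewrite (ldim_represents bs _ NW) ?(ldim_represents bs _ NW'); try by move=> v [].
by apply/mxrankS/rV_subP => u /NW[su Wu]; apply/NW'; split=> //; exact: WW'.
Qed.

(** Here [s] stands for the union and [t] for the intersection. The inequality reduces to the
    dimension formula for the row spaces of [A1 + N] and [A2 + N]. *)
Lemma relrank_submod W s1 s2 s t : subspace W -> {subset s <= s1 ++ s2} ->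
  {subset t <= s1} -> {subset t <= s2} ->
  (relrank W (lspan s) + relrank W (lspan t) <=
   relrank W (lspan s1) + relrank W (lspan s2))%N.
Proof.
move=> subW /lspanS ss /lspanS t1 /lspanS t2.
have [b bU _] := lbasis_lspan (s1 ++ s2).
have U1 : lspan s1 `<=` lspan (s1 ++ s2) by apply: lspanS => x; rewrite mem_cat => ->.
have U2 : lspan s2 `<=` lspan (s1 ++ s2).
  by apply: lspanS => x; rewrite mem_cat orbC => ->.
have [N NW] := mx_represents_exists b subW.
have [A AY] := mx_represents_exists b (lspan_subspace s).
have [C CY] := mx_represents_exists b (lspan_subspace t).
have [A1 AY1] := mx_represents_exists b (lspan_subspace s1).
have [A2 AY2] := mx_represents_exists b (lspan_subspace s2).
have sA : (A <= A1 + A2)%MS.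
  have [/lfreeP injb bs] := bU.
  apply/rV_subP => u /AY/ss uU.
  (* [P] is the sum of the spans of [s1] and [s2]; being a subspace that contains both families, it
     contains the span of [s1 ++ s2]. *)
  pose P : set M := [set lcomb v | v in [set v | (v <= A1 + A2)%MS]].
  suff /(_ _ uU)[v /= vA /injb <-//] : lspan (s1 ++ s2) `<=` P.
  apply: lspan_min.
    split; first by exists 0; [exact: sub0mx|exact: linear0].
    move=> a _ _ [v /= vA <-] [w /= wA <-]; exists (a *: v + w); last exact: linearP.
    by rewrite /= addmx_sub ?scalemx_sub.
  move=> x xs; have := mem_lspan xs; rewrite -bs => /lspanP[v xv]; exists v => //=.
  move: xs; rewrite xv mem_cat => /orP[] /mem_lspan.
    by move=> /AY1/submx_trans; apply; exact: addsmxSl.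
  by move=> /AY2/submx_trans; apply; exact: addsmxSr.
have CA1 : (C <= A1)%MS by apply/rV_subP => u /CY/t1/AY1.
have CA2 : (C <= A2)%MS by apply/rV_subP => u /CY/t2/AY2.
(* One copy of [\rank N] for each relative rank turns all four into ranks of sums with [N]. *)
rewrite -(leq_add2r (\rank N + \rank N)) addnACA [leqRHS]addnACA.
rewrite (relrank_represents bU ss AY NW).
rewrite (relrank_represents bU (subset_trans t1 U1) CY NW).
rewrite (relrank_represents bU U1 AY1 NW) (relrank_represents bU U2 AY2 NW).
rewrite -(mxrank_sum_cap (A1 + N)%MS) leq_add// mxrankS//.
  rewrite addsmx_sub (submx_trans sA) ?addsmxS ?addsmxSl//.
  by rewrite (submx_trans (addsmxSr A1 N)) ?addsmxSl.
by rewrite sub_capmx !addsmxS.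
Qed.

End LinearAlgebra.

(** * Spaces of boundaries and the cophenetic rank *)

Section Boundaries.
Context (R : realType) (disp : Order.disp_t) (V : orderType disp).
Implicit Types (K L : simplicial_complex V) (k : nat).

(** Summing over any set containing the support lets several chains share one index set, as
    linearity requires. *)
Lemma boundaryEw k (D : {fset {fset V}}) (c : {malg R[{fset V}]}) :
  (msupp c `<=` D)%fset ->
  boundary k.+1 c = \sum_(s <- D) c@_s *: simplex_boundary R s.
Proof.
move=> cD; apply: big_fset_incl => // s _ /mcoeff_outdom ->.
by rewrite scale0r.
Qed.

Lemma boundary_linear k : linear (@boundary R _ V k.+1).
Proof.
move=> a c d; pose D := (msupp c `|` msupp d)%fset.
have acD : (msupp (a *: c + d) `<=` D)%fset.
  by apply: fsubset_trans (msuppD_le _ _) _; rewrite fsetSU ?msuppZ_le.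
rewrite !(@boundaryEw k D) ?fsubsetUl ?fsubsetUr//.
rewrite scaler_sumr -big_split; apply: eq_bigr => s _ /=.
by rewrite mcoeffD mcoeffZ scalerDl scalerA.
Qed.

Lemma chains_subspace K k : subspace (chains R K k).
Proof.
split=> [s|a c d Kc Kd s]; first by rewrite msupp0 inE.
by move=> /(fsubsetP (msuppD_le _ _)) /fsetUP[/(fsubsetP (msuppZ_le _ _))/Kc|/Kd].
Qed.

Lemma boundaries_subspace K k : subspace (boundaries R K k).
Proof.
have [K0 KD] := chains_subspace K k.+1; split.
  by exists 0 => //; rewrite /boundary msupp0 big_seq_fset0.
move=> a _ _ [c Kc <-] [d Kd <-]; exists (a *: c + d); first exact: KD.
exact: boundary_linear.
Qed.

Lemma sub_boundaries K L k : K `<=` L -> boundaries R K k `<=` boundaries R L k.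
Proof. by move=> KL _ [c Kc <-]; exists c => // s /Kc[/KL]. Qed.

(** By unfolding, the cophenetic rank is [relrank] with respect to the boundaries, so the axioms are
    instances of the lemmas on [relrank]. *)
Lemma cophenetic_rank_matroid K k : is_matroid (cophenetic_rank R K k).
Proof.
have subB := boundaries_subspace K k.
split=> [A B AB|A|A B].
- apply: (relrank_mono subB); apply: lspanS.
  by move=> x /imfsetP[z /= /(fsubsetP AB) zB ->]; exact: in_imfset.
- by apply: leq_trans (relrank_size _ _) _; rewrite leq_imfset_card.
- apply: (relrank_submod subB) => x /imfsetP[z /= zAB ->].
  + rewrite mem_cat; move: zAB => /fsetUP[] zA; apply/orP; [left|right];
      exact: in_imfset.
  + by move: zAB => /fsetIP[zA _]; exact: in_imfset.
  + by move: zAB => /fsetIP[_ zB]; exact: in_imfset.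
Qed.

(** The image of [A] consists of the same chains, so its span does not grow, while the space of
    boundaries is enlarged. *)
Lemma cophenetic_rank_incl K L k (KL : K `<=` L) (A : {fset cycles R K k}) :
  (cophenetic_rank R L k [fset cycles_incl R k KL z | z in A]%fset
     <= cophenetic_rank R K k A)%N.
Proof.
apply: leq_trans (relrank_anti _ (boundaries_subspace K k)
  (boundaries_subspace L k) (sub_boundaries KL)).
apply: (relrank_mono (boundaries_subspace L k)); apply: lspanS.
move=> x /imfsetP[_ /= /imfsetP[z /= zA ->] ->]; exact: in_imfset.
Qed.

End Boundaries.

Theorem theorem3p2 (R : realType) (disp : Order.disp_t) (V : orderType disp)
    (K : {nonneg R} -> simplicial_complex V)
    (K_incl : forall e h : {nonneg R}, (e <= h)%O -> K e `<=` K h) :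
  (forall (e : {nonneg R}) (k : nat), submodular (cophenetic_rank R (K e) k)) /\
  (forall k : nat,
     is_filtered_matroid
       (fun e : {nonneg R} => cophenetic_rank R (K e) k)
       (fun (e h : {nonneg R}) (eh : (e <= h)%O) =>
          cycles_incl R k (K_incl e h eh))).
Proof.
split=> [e k|k]; first exact/matroid_submod/cophenetic_rank_matroid.
split=> [e|e h t eh ht et z|e h eh A].
- exact: cophenetic_rank_matroid.
(* Both sides have the same underlying chain. *)
- exact: val_inj.
- exact: cophenetic_rank_incl.
Qed.
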